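(* Let $A\in\mathcal{V}$ be an algebra such that $K(A)$ is closed under the commutator operation. If $\theta\in Con(A)$ then $Ann(\theta^{\ast})=(\theta\rightarrow\rho(\Delta_A))^{\ast}$; if $A$ is semiprime then $Ann(\theta^{\ast})=(\theta^{\perp})^{\ast}$.
   Context: $\mathcal{V}$ is a fixed congruence-modular variety of algebras (of a finite signature) that is semidegenerate: no nontrivial algebra in $\mathcal{V}$ has one-element subalgebras (equivalently, $\nabla_A$ is compact in $Con(A)$ for every $A\in\mathcal{V}$). For $A\in\mathcal{V}$, $Con(A)$ is the complete lattice of congruences of $A$, with least element $\Delta_A$ and greatest element $\nabla_A$; $K(A)$ is the set of compact (= finitely generated) congruences. Commutator: $[\cdot,\cdot]=[\cdot,\cdot]_A$ is the (modular) commutator, i.e. the greatest operation on the congruence lattices of members of $\mathcal{V}$ such that for every surjective morphism $f:A\to B$ in $\mathcal{V}$ and all $\alpha,\beta\in Con(A)$: $[\alpha,\beta]_A\subseteq\alpha\cap\beta$ and $[\alpha,\beta]_A\vee Ker(f)=f^{-1}([f(\alpha\vee Ker(f)),f(\beta\vee Ker(f))]_B)$. Residuation: $\alpha\rightarrow\beta=\bigvee\{\gamma\in Con(A)\mid[\alpha,\gamma]\subseteq\beta\}$ and $\alpha^{\perp}=\alpha\rightarrow\Delta_A$. $\phi\in Con(A)\setminus\{\nabla_A\}$ is prime if $[\alpha,\beta]\subseteq\phi$ implies $\alpha\subseteq\phi$ or $\beta\subseteq\phi$ (for $\alpha,\beta\in Con(A)$); $Spec(A)$ is the set of prime congruences;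 $\rho(\theta)=\bigcap\{\phi\in Spec(A)\mid\theta\subseteq\phi\}$; $A$ is semiprime if $\rho(\Delta_A)=\Delta_A$. Reticulation: when $K(A)$ is closed under the commutator, $L(A)=K(A)/{\equiv}$ where $\alpha\equiv\beta$ iff $\rho(\alpha)=\rho(\beta)$; $\lambda_A:K(A)\to L(A)$ is the quotient map; $L(A)$ is a bounded distributive lattice with $\lambda_A(\alpha)\vee\lambda_A(\beta)=\lambda_A(\alpha\vee\beta)$, $\lambda_A(\alpha)\wedge\lambda_A(\beta)=\lambda_A([\alpha,\beta])$, $0=\lambda_A(\Delta_A)$, $1=\lambda_A(\nabla_A)$. For $\theta\in Con(A)$, $\theta^{\ast}=\{\lambda_A(\alpha)\mid\alpha\in K(A),\alpha\subseteq\theta\}$, an ideal of $L(A)$. For an ideal $I$ of a bounded distributive lattice $L$, $Ann(I)=\{x\in L\mid x\wedge y=0\text{ for all }y\in I\}$. *)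

(* Defs.v *)
From HB Require Import structures.
From mathcomp Require Import all_boot all_order generic_quotient.
From mathcomp Require Import boolp classical_sets.

Set Implicit Arguments.
Unset Strict Implicit.
Unset Printing Implicit Defensive.

Import Order.TTheory.
Local Open Scope order_scope.

#[local] Obligation Tactic := idtac.

Record signature := Signature { symbol :> finType; arity : symbol -> nat }.

Record algebra (S : signature) := Algebra {
  carrier :> Type;
  interp : forall f : S, ('I_(arity f) -> carrier) -> carrier;
  carrier_inhabited : inhabited carrier }.
Arguments interp {S A} f x : rename.

Definition is_morphism S (A B : algebra S) (h : A -> B) : Prop :=
  forall (f : S) (x : 'I_(arity f) -> A), h (interp f x) = interp f (h \o x).

Record surj_morphism S (A B : algebra S) := SurjMorphism {
  surj_fun :> A -> B;
  surj_is_morphism : is_morphism surj_fun;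
  surj_onto : forall b, exists a, surj_fun a = b }.

Definition subuniverse S (A : algebra S) (X : set A) : Prop :=
  forall (f : S) (x : 'I_(arity f) -> A), (forall i, X (x i)) -> X (interp f x).

Definition subalgebra S (A : algebra S) (X : set A)
    (X_sub : subuniverse X) (X0 : exists a, X a) : algebra S :=
  @Algebra S {a : A | X a}
    (fun f x => exist _ (interp f (fun i => sval (x i)))
                  (X_sub f _ (fun i => svalP (x i))))
    (let: ex_intro a Xa := X0 in inhabits (exist _ a Xa)).

Lemma prod_inhabited S (I : Type) (A : I -> algebra S) :
  inhabited (forall i, A i).
Proof.
suff e i : {a : A i | True} by exact: inhabits (fun i => sval (e i)).
by apply: cid; case: (carrier_inhabited (A i)) => a; exists a.
Qed.

Definition prod_algebra S (I : Type) (A : I -> algebra S) : algebra S :=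
  @Algebra S (forall i, A i) (fun f x i => interp f (fun j => x j i))
    (prod_inhabited A).

Record variety (S : signature) := Variety {
  member :> algebra S -> Prop;
  variety_H : forall (A B : algebra S) (f : surj_morphism A B),
    member A -> member B;
  variety_S : forall (A : algebra S) (X : set A)
    (X_sub : subuniverse X) (X0 : exists a, X a),
    member A -> member (subalgebra X_sub X0);
  variety_P : forall (I : Type) (A : I -> algebra S),
    (forall i, member (A i)) -> member (prod_algebra A) }.

Definition semidegenerate S (V : variety S) : Prop :=
  forall A : algebra S, V A -> (exists a b : A, a <> b) ->
    ~ exists a : A, subuniverse [set a]%classic.

Record con S (A : algebra S) := Con {
  con_rel :> A -> A -> Prop;
  con_refl : forall x, con_rel x x;
  con_sym : forall x y, con_rel x y -> con_rel y x;
  con_trans : forall x y z, con_rel x y -> con_rel y z -> con_rel x z;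
  con_compat : forall (f : S) (x y : 'I_(arity f) -> A),
    (forall i, con_rel (x i) (y i)) -> con_rel (interp f x) (interp f y) }.

Section CongruenceLattice.
Context {S : signature} {A : algebra S}.
Implicit Types (a b c : con A) (X : set (con A)).

Lemma conP a b : (forall x y, a x y <-> b x y) -> a = b.
Proof.
case: a b => [r r1 r2 r3 r4] [q q1 q2 q3 q4] /= e.
have {}e : r = q by apply: funext => x; apply: funext => y; apply: propext.
by case: _ / e in q1 q2 q3 q4 *; congr Con; exact: Prop_irrelevance.
Qed.

HB.instance Definition _ := gen_eqMixin (con A).
HB.instance Definition _ := gen_choiceMixin (con A).

Definition con_le a b : bool := `[< forall x y, a x y -> b x y >].

Lemma con_le_refl : reflexive con_le.
Proof. by move=> a; apply/asboolP. Qed.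

Lemma con_le_anti : antisymmetric con_le.
Proof.
move=> a b /andP[/asboolP ab /asboolP ba].
by apply: conP => x y; split; [exact: ab|exact: ba].
Qed.

Lemma con_le_trans : transitive con_le.
Proof.
move=> b a c /asboolP ab /asboolP bc.
by apply/asboolP => x y /ab/bc.
Qed.

HB.instance Definition _ := Order.Le_isPOrder.Build (Order.Disp tt tt) (con A)
  con_le_refl con_le_anti con_le_trans.

Lemma con_leP a b : reflect (forall x y, a x y -> b x y) (a <= b).
Proof. exact: asboolP. Qed.

(* For empty X this is the total congruence. *)
Program Definition con_inf X : con A :=
  @Con S A (fun x y => forall a, X a -> a x y) _ _ _ _.
Next Obligation. by move=> X x a _; exact: con_refl. Qed.
Next Obligation. by move=> X x y h a Xa; apply: con_sym; exact: h. Qed.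
Next Obligation.
by move=> X x y z h k a Xa; apply: con_trans (h _ Xa) (k _ Xa).
Qed.
Next Obligation. by move=> X f x y h a Xa; apply: con_compat => i; exact: h. Qed.

Definition con_gen (r : A -> A -> Prop) : con A :=
  con_inf (fun a => forall x y, r x y -> a x y).

Definition con_sup X : con A := con_gen (fun x y => exists2 a, X a & a x y).

Definition con_meet a b : con A := con_inf [set a; b]%classic.
Definition con_join a b : con A := con_sup [set a; b]%classic.

Program Definition con_bot : con A := @Con S A eq _ _ _ _.
Next Obligation. by []. Qed.
Next Obligation. by move=> x y ->. Qed.
Next Obligation. by move=> x y z -> ->. Qed.
Next Obligation. by move=> f x y h; congr interp; apply: funext. Qed.

Program Definition con_top : con A := @Con S A (fun _ _ => True) _ _ _ _.
Solve All Obligations with by [].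

Lemma con_infP X b : (b <= con_inf X) <-> (forall a, X a -> b <= a).
Proof.
split=> [/con_leP h a Xa|h]; apply/con_leP => x y bxy; first exact: h.
by move=> a Xa; move/con_leP: (h _ Xa); exact.
Qed.

Lemma con_genP (r : A -> A -> Prop) b :
  (con_gen r <= b) <-> (forall x y, r x y -> b x y).
Proof.
split=> [/con_leP h x y rxy|h]; first by apply: h => a; exact.
by apply/con_leP => x y /(_ b); exact.
Qed.

Lemma con_supP X b : (con_sup X <= b) <-> (forall a, X a -> a <= b).
Proof.
split=> [/con_genP h a Xa|h].
  by apply/con_leP => x y axy; apply: h; exists a.
by apply/con_genP => x y [a /h/con_leP]; exact.
Qed.

Lemma con_meetP a b c : (a <= con_meet b c) = (a <= b) && (a <= c).
Proof.
apply/idP/andP => [/con_infP h|[ab ac]].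
  by split; apply: h; [left|right].
by apply/con_infP => _ [->|->].
Qed.

Lemma con_joinP a b c : (con_join a b <= c) = (a <= c) && (b <= c).
Proof.
apply/idP/andP => [/con_supP h|[ac bc]].
  by split; apply: h; [left|right].
by apply/con_supP => _ [->|->].
Qed.

HB.instance Definition _ :=
  Order.POrder_MeetJoin_isLattice.Build (Order.Disp tt tt) (con A)
    con_meetP con_joinP.

Lemma con_le0 a : con_bot <= a.
Proof. by apply/con_leP => x y ->; exact: con_refl. Qed.

Lemma con_le1 a : a <= con_top.
Proof. exact/con_leP. Qed.

HB.instance Definition _ :=
  Order.hasBottom.Build (Order.Disp tt tt) (con A) con_le0.
HB.instance Definition _ :=
  Order.hasTop.Build (Order.Disp tt tt) (con A) con_le1.

Definition compact a : Prop :=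
  forall X, a <= con_sup X ->
  exists2 s : seq (con A), (forall b, b \in s -> X b) & a <= \join_(b <- s) b.

Definition finitely_generated a : Prop :=
  exists n (u v : 'I_n -> A),
    a = con_gen (fun x y => exists i, x = u i /\ y = v i).

Lemma join_mem (s : seq (con A)) b : b \in s -> b <= \join_(c <- s) c.
Proof. by move=> bs; exact: (@joins_sup_seq _ _ _ s xpredT id b). Qed.

Lemma join_sub (s t : seq (con A)) : {subset s <= t} ->
  \join_(c <- s) c <= \join_(c <- t) c.
Proof. by move=> st; apply/joinsP_seq => c /st cs _; exact: join_mem. Qed.

Lemma con_sup_finitary X n (u v : 'I_n -> A) :
  (forall i, exists2 s : seq (con A), (forall b, b \in s -> X b) &
     (\join_(b <- s) b : con A) (u i) (v i)) ->
  exists2 s : seq (con A), (forall b, b \in s -> X b) &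
     forall i, (\join_(b <- s) b : con A) (u i) (v i).
Proof.
move=> h; pose s i := s2val (cid2 (h i)).
exists (flatten [seq s i | i <- enum 'I_n]) => [b /flatten_mapP[i _]|i].
  by rewrite /s; case: cid2 => /= t tX _; exact: tX.
apply: (con_leP _ _ (@join_sub (s i) _ _)).
  by move=> b bs; apply/flatten_mapP; exists i => //; rewrite mem_enum.
by rewrite /s; case: cid2.
Qed.

Lemma con_sup_fin X x y : con_sup X x y ->
  exists2 s : seq (con A), (forall b, b \in s -> X b) &
    (\join_(b <- s) b : con A) x y.
Proof.
set R := fun x y => exists2 s : seq (con A), (forall b, b \in s -> X b) &
    (\join_(b <- s) b : con A) x y.
have R1 z : R z z by exists [::] => //; exact: con_refl.
have R2 z t : R z t -> R t z by case=> s sX h; exists s => //; exact: con_sym.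
have R3 z t w : R z t -> R t w -> R z w.
  case=> s sX h [s' sX' h']; exists (s ++ s').
    by move=> b; rewrite mem_cat => /orP[/sX|/sX'].
  apply: (@con_trans _ _ _ _ t).
    by apply: (con_leP _ _ (@join_sub s _ _)) h => b; rewrite mem_cat => ->.
  by apply: (con_leP _ _ (@join_sub s' _ _)) h' => b;
    rewrite mem_cat orbC => ->.
have R4 (f : S) (u v : 'I_(arity f) -> A) :
    (forall i, R (u i) (v i)) -> R (interp f u) (interp f v).
  by case/con_sup_finitary => s sX h; exists s => //; exact: con_compat.
move=> /(_ (Con R1 R2 R3 R4)); apply => z t [a Xa azt] /=; exists [:: a].
  by move=> b; rewrite inE => /eqP ->.
by rewrite big_seq1.
Qed.

Lemma finitely_generatedU a b :
  finitely_generated a -> finitely_generated b ->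
  finitely_generated (a `|` b).
Proof.
move=> [m [u [v ->]]] [n [u' [v' ->]]]; exists (m + n)%N.
exists (fun i => match split i with inl j => u j | inr k => u' k end).
exists (fun i => match split i with inl j => v j | inr k => v' k end).
apply/le_anti/andP; split; last first.
  apply/con_genP => x y [i]; case: (split i) => j [-> ->].
    by apply: (con_leP _ _ (leUl _ _)) => c; apply; exists j.
  by apply: (con_leP _ _ (leUr _ _)) => c; apply; exists j.
rewrite leUx; apply/andP; split; apply/con_genP => x y [j [-> ->]] c; apply.
  by exists (unsplit (inl j)); rewrite unsplitK.
by exists (unsplit (inr j)); rewrite unsplitK.
Qed.

Lemma compactP a : compact a <-> finitely_generated a.
Proof.
split=> [ca|[n [u [v ->]]] X le_X].
  pose X : set (con A) :=
    fun b => exists x y, a x y /\ b = con_gen (fun z t => z = x /\ t = y).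
  case: (ca X) => [|s sX le_s].
    apply/con_leP => x y axy b; apply.
    by exists (con_gen (fun z t => z = x /\ t = y));
      [exists x, y|move=> c; exact].
  have -> : a = \join_(b <- s) b.
    apply/le_anti; rewrite le_s; apply/joinsP_seq => b /sX [x [y [axy ->]]] _.
    by apply/con_genP => _ _ [-> ->].
  elim: s sX {le_s} => [_|b s IHs sX].
    have no : 'I_0 -> A by case.
    exists 0%N, no, no.
    rewrite big_nil; apply/le_anti; rewrite le0x.
    by apply/con_genP => x y [[]].
  rewrite big_cons; apply: finitely_generatedU; last first.
    by apply: IHs => c cs; apply: sX; rewrite inE cs orbT.
  have [x [y [_ ->]]] := sX b (mem_head _ _).
  exists 1%N, (fun=> x), (fun=> y); congr con_gen.
  apply: funext => z; apply: funext => t; apply: propext.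
  by split=> [|[]//]; exists ord0.
have [|s sX h] := @con_sup_finitary X n u v.
  by move=> i; apply/con_sup_fin/(con_leP _ _ le_X) => c; apply; exists i.
by exists s => //; apply/con_genP => x y [i [-> ->]].
Qed.

Lemma compact0 : compact \bot.
Proof. by move=> X _; exists [::] => //; exact: le0x. Qed.

Lemma compactU a b : compact a -> compact b -> compact (a `|` b).
Proof.
by rewrite !compactP; exact: finitely_generatedU.
Qed.

End CongruenceLattice.

Arguments con_le {S A} : simpl never.
Arguments compact0 {S A} X _.
Arguments compactU {S A a b} _ _ X _.

Definition congruence_modular S (V : variety S) : Prop :=
  forall A : algebra S, V A -> forall a b c : con A,
    a <= c -> a `|` (b `&` c) = (a `|` b) `&` c.

Section Quotient.
Context {S : signature} {A : algebra S} (a : con A).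

Definition quot_carrier := {X : set A | exists x, X = a x}.

Definition quot_class (x : A) : quot_carrier :=
  exist _ (a x : set A) (ex_intro _ x erefl).

Lemma quot_class_eq x y : quot_class x = quot_class y <-> a x y.
Proof.
split=> [[->]|axy]; first exact: con_refl.
apply: eq_exist => /=; apply: funext => z; apply: propext.
split; first by apply: con_trans; exact: con_sym.
exact: con_trans.
Qed.

Lemma quot_classP (X : quot_carrier) : {x | X = quot_class x}.
Proof. by apply: cid; case: X => X [x e]; exists x; exact: eq_exist. Qed.

Definition quot_algebra : algebra S :=
  @Algebra S quot_carrier
    (fun f X => quot_class (interp f (fun i => sval (quot_classP (X i)))))
    (let: inhabits x := carrier_inhabited A in inhabits (quot_class x)).

Lemma quot_class_morphism : @is_morphism S A quot_algebra quot_class.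
Proof.
move=> f x; apply/quot_class_eq/con_compat => i; apply/quot_class_eq.
by case: quot_classP.
Qed.

Definition quot_map : surj_morphism A quot_algebra :=
  @SurjMorphism _ A quot_algebra quot_class quot_class_morphism
    (fun X => let: exist x e := quot_classP X in ex_intro _ x (esym e)).

End Quotient.

Lemma semidegenerate_compact1 S (V : variety S) (A : algebra S) :
  semidegenerate V -> V A -> compact (\top : con A).
Proof.
move=> V_sd AV; apply/compactP; have [x0] := carrier_inhabited A.
exists #|S|, (fun=> x0), (fun i => interp (enum_val i) (fun=> x0)).
set a := con_gen _; apply/esym/le_anti; rewrite lex1.
apply/con_leP => x y _; apply: contrapT => naxy.
have QV : V (quot_algebra a) := variety_H (quot_map a) AV.
apply: (V_sd _ QV).
  by exists (quot_class a x), (quot_class a y) => /quot_class_eq.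
exists (quot_class a x0) => f X X0 /=.
have -> : X = quot_class a \o (fun=> x0) by apply: funext => i; exact: X0.
rewrite -[LHS](quot_class_morphism a); apply/quot_class_eq/con_sym => b; apply.
by exists (enum_rank f); rewrite enum_rankK.
Qed.

Section Images.
Context {S : signature} {A B : algebra S} (f : surj_morphism A B).

Program Definition con_preim (b : con B) : con A :=
  @Con S A (fun x y => b (f x) (f y)) _ _ _ _.
Next Obligation. by move=> b x; exact: con_refl. Qed.
Next Obligation. by move=> b x y; exact: con_sym. Qed.
Next Obligation. by move=> b x y z; exact: con_trans. Qed.
Next Obligation.
by move=> b g x y h /=; rewrite !surj_is_morphism; exact: con_compat.
Qed.

Definition ker : con A := con_preim \bot.

(* When ker <= a, the relation f(a) is already a congruence; see con_imageE. *)
Definition con_image (a : con A) : con B :=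
  con_gen (fun u v => exists x y, [/\ f x = u, f y = v & a x y]).

Lemma con_imageE (a : con A) u v : ker <= a ->
  con_image a u v <-> exists x y, [/\ f x = u, f y = v & a x y].
Proof.
move/con_leP => ka; set R := fun u v => exists x y, [/\ f x = u, f y = v & a x y].
have R1 w : R w w.
  by have [x <-] := surj_onto f w; exists x, x; split=> //; exact: con_refl.
have R2 w t : R w t -> R t w.
  by case=> x [y [<- <- h]]; exists y, x; split=> //; exact: con_sym.
have R3 w t z : R w t -> R t z -> R w z.
  case=> x [y [<- <- h]] [x' [y' [e <- h']]]; exists x, y'; split=> //.
  by apply: con_trans h (con_trans _ h'); apply: ka; rewrite /= e.
have R4 (g : S) (p q : 'I_(arity g) -> B) :
    (forall i, R (p i) (q i)) -> R (interp g p) (interp g q).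
  move=> h; pose x i := sval (cid (h i)).
  pose y i := sval (cid (svalP (cid (h i)))).
  have xy i : [/\ f (x i) = p i, f (y i) = q i & a (x i) (y i)].
    exact: svalP (cid (svalP (cid (h i)))).
  exists (interp g x), (interp g y); split.
  - by rewrite surj_is_morphism; congr interp; apply: funext => i; case: (xy i).
  - by rewrite surj_is_morphism; congr interp; apply: funext => i; case: (xy i).
  - by apply: con_compat => i; case: (xy i).
split=> [/(_ (Con R1 R2 R3 R4))|Ruv b]; last exact.
by apply.
Qed.

End Images.

Section Commutator.
Context {S : signature} (V : variety S).

(* Values of C outside V are irrelevant. *)
Definition commutator_like (C : forall A : algebra S, con A -> con A -> con A) :
    Prop :=
  (forall A, V A -> forall a b : con A, C A a b <= a `&` b) /\
  (forall A B (f : surj_morphism A B), V A -> V B -> forall a b : con A,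
     C A a b `|` ker f =
     con_preim f (C B (con_image f (a `|` ker f)) (con_image f (b `|` ker f)))).

(* The greatest such operation always exists, as the pointwise join of all of
   them; see commutator_is_like and commutator_greatest. *)
Definition commutator (A : algebra S) (a b : con A) : con A :=
  con_sup (fun c => exists2 C, commutator_like C & c = C A a b).

Lemma commutator_greatest C : commutator_like C ->
  forall A (a b : con A), C A a b <= commutator a b.
Proof.
by move=> CP A a b; move/con_supP: (lexx (commutator a b)); apply; exists C.
Qed.

Lemma commutator_leI A : V A -> forall a b : con A, commutator a b <= a `&` b.
Proof. by move=> AV a b; apply/con_supP => _ [C [+ _] ->]; exact. Qed.

Lemma commutator_is_like : commutator_like commutator.
Proof.
split=> [|A B f AV BV a b]; first exact: commutator_leI.
set a' := con_image f _; set b' := con_image f _.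
apply/le_anti/andP; split.
  rewrite leUx; apply/andP; split.
    apply/con_supP => _ [C CP ->]; apply: (le_trans (leUl _ (ker f))).
    rewrite CP.2 //; apply/con_leP => x y /=.
    exact: (con_leP _ _ (commutator_greatest CP a' b')).
  by apply/con_leP => x y /= -> c _; exact: con_refl.
set g := commutator a b `|` ker f.
have kg : ker f <= g by exact: leUr.
have le_g : commutator a' b' <= con_image f g.
  apply/con_supP => _ [C CP ->]; apply/con_leP => u v.
  have [x <-] := surj_onto f u; have [y <-] := surj_onto f v => h.
  apply/con_imageE => //; exists x, y; split=> //.
  have {}h : con_preim f (C B a' b') x y by [].
  move: h; rewrite -(CP.2 A B f) //; apply: (con_leP _ _ _).
  by apply: leU2 => //; exact: commutator_greatest.
apply/con_leP => x y /= /(con_leP _ _ le_g)/con_imageE -/(_ kg).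
move=> [x' [y' [ex ey h]]].
have kx : g x x' by apply: (con_leP _ _ kg); rewrite /= ex.
have ky : g y' y by apply: (con_leP _ _ kg); rewrite /= ey.
exact: con_trans kx (con_trans h ky).
Qed.

Context {A : algebra S}.
Implicit Types a b : con A.

Definition residuum a b : con A := con_sup (fun c => commutator a c <= b).

Definition perp a : con A := residuum a \bot.

Definition prime_con (p : con A) : Prop :=
  p <> \top /\ forall a b, commutator a b <= p -> a <= p \/ b <= p.

Definition rho a : con A := con_inf (fun p => prime_con p /\ a <= p).

End Commutator.

Definition semiprime S (V : variety S) (A : algebra S) : Prop :=
  rho V (\bot : con A) = \bot.

Section CompactCongruences.
Context {S : signature} (V : variety S) (A : algebra S).

Definition K := {a : con A | `[< compact a >]}.

Definition inK (a : con A) (ca : compact a) : K := exist _ a (asboolT ca).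

Lemma K_compact (a : K) : compact (sval a).
Proof. by case: a => a /= /asboolP. Qed.

HB.instance Definition _ := Choice.on K.

Definition rho_equiv (a b : K) : bool :=
  rho V (sval a) == rho V (sval b).

Lemma rho_equiv_refl : reflexive rho_equiv.
Proof. by move=> a; exact: eqxx. Qed.

Lemma rho_equiv_sym : symmetric rho_equiv.
Proof. by move=> a b; exact: eq_sym. Qed.

Lemma rho_equiv_trans : transitive rho_equiv.
Proof. by move=> b a c /eqP ab /eqP bc; apply/eqP; rewrite ab. Qed.

Canonical rho_equiv_rel :=
  EquivRel rho_equiv rho_equiv_refl rho_equiv_sym rho_equiv_trans.

Definition K_commutator_closed : Prop :=
  forall a b : con A, compact a -> compact b -> compact (commutator V a b).

End CompactCongruences.

Arguments K_compact {S A} a X _.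

Section Reticulation.
Context {S : signature} {V : variety S} (V_sd : semidegenerate V).
Context {A : algebra S} (AV : V A) (KA : K_commutator_closed V A).

(* V_sd, AV and KA are needed for the lattice structure, not for the carrier. *)
Definition reticulation of semidegenerate V & V A & K_commutator_closed V A :=
  {eq_quot (rho_equiv_rel V A)}%qT.

Local Notation L := (reticulation V_sd AV KA).

HB.instance Definition _ := Choice.on L.

Definition lambda (a : K A) : L := (\pi_{eq_quot (rho_equiv_rel V A)} a)%qT.

Definition ret_repr (x : L) : K A :=
  repr (x : {eq_quot (rho_equiv_rel V A)}%qT).

Lemma ret_reprK : cancel ret_repr lambda.
Proof. by move=> x; exact: reprK. Qed.

Lemma lambda_eq (a b : K A) :
  lambda a = lambda b <-> rho V (sval a) = rho V (sval b).
Proof.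
split=> [/eqmodP/eqP//|e]; by apply/eqmodP/eqP.
Qed.

Definition ret_meet (x y : L) : L :=
  lambda (inK (KA (K_compact (ret_repr x)) (K_compact (ret_repr y)))).

Definition ret_join (x y : L) : L :=
  lambda (inK (compactU (K_compact (ret_repr x)) (K_compact (ret_repr y)))).

Definition ret_bot : L := lambda (inK compact0).

Definition ret_top : L := lambda (inK (semidegenerate_compact1 V_sd AV)).

Lemma rho_prime (a b : con A) :
  rho V a = rho V b <-> forall p, prime_con V p -> (a <= p) = (b <= p).
Proof.
split=> [e p pp|e].
  have le_rho (c : con A) : c <= rho V c by apply/con_infP => q [].
  have rho_le (c : con A) : c <= p -> rho V c <= p.
    by move=> cp; move/con_infP: (lexx (rho V c)); apply.
  apply/idP/idP => h.
    by apply: (le_trans (le_rho b)); rewrite -e rho_le.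
  by apply: (le_trans (le_rho a)); rewrite e rho_le.
by congr con_inf; apply: funext => p; apply: propext;
  split=> -[pp h]; split=> //; rewrite ?e // -?e.
Qed.

Let below (x : L) (p : con A) : bool := sval (ret_repr x) <= p.

Lemma below_lambda a p : prime_con V p -> below (lambda a) p = (sval a <= p).
Proof.
move=> pp; move: p pp; apply/rho_prime/lambda_eq; exact: ret_reprK.
Qed.

Lemma ret_eqP (x y : L) :
  (forall p, prime_con V p -> below x p = below y p) -> x = y.
Proof.
by move=> h; rewrite -[x]ret_reprK -[y]ret_reprK; apply/lambda_eq/rho_prime.
Qed.

Lemma commutator_prime (a b p : con A) : prime_con V p ->
  (commutator V a b <= p) = (a <= p) || (b <= p).
Proof.
move=> pp; apply/idP/orP => [/pp.2 //|].
have := commutator_leI AV a b; rewrite lexI => /andP[ca cb].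
by case; apply: le_trans.
Qed.

Lemma belowI x y p : prime_con V p ->
  below (ret_meet x y) p = below x p || below y p.
Proof. by move=> pp; rewrite below_lambda // commutator_prime. Qed.

Lemma belowU x y p : prime_con V p ->
  below (ret_join x y) p = below x p && below y p.
Proof. by move=> pp; rewrite below_lambda // leUx. Qed.

Let ret_le (x y : L) : bool := ret_meet x y == x.
Let ret_lt (x y : L) : bool := (y != x) && ret_le x y.

Local Ltac ret_law :=
  repeat move=> ?; apply: ret_eqP => p pp; rewrite !(belowI, belowU) //;
  do ?case: below => //=.

Fact ret_meetC : commutative ret_meet. Proof. ret_law. Qed.
Fact ret_joinC : commutative ret_join. Proof. ret_law. Qed.
Fact ret_meetA : associative ret_meet. Proof. ret_law. Qed.
Fact ret_joinA : associative ret_join. Proof. ret_law. Qed.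
Fact ret_joinKI y x : ret_meet x (ret_join x y) = x. Proof. ret_law. Qed.
Fact ret_meetKU y x : ret_join x (ret_meet x y) = x. Proof. ret_law. Qed.
Fact ret_meetUl : left_distributive ret_meet ret_join. Proof. ret_law. Qed.
Fact ret_meetxx : idempotent_op ret_meet. Proof. ret_law. Qed.

HB.instance Definition _ :=
  Order.isMeetJoinDistrLattice.Build (Order.Disp tt tt) L
    (fun x y => erefl (ret_le x y)) (fun x y => erefl (ret_lt x y))
    ret_meetC ret_joinC ret_meetA ret_joinA ret_joinKI ret_meetKU
    ret_meetUl ret_meetxx.

Fact ret_le0x (x : L) : ret_bot <= x.
Proof.
rewrite leEmeet; apply/eqP/ret_eqP => p pp.
by rewrite belowI // below_lambda //= le0x.
Qed.

Fact ret_lex1 (x : L) : x <= ret_top.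
Proof.
rewrite leEmeet; apply/eqP/ret_eqP => p pp.
rewrite belowI // below_lambda //= orbC.
suff /negbTE -> : ~~ (\top <= p :> con A) by [].
by rewrite le1x; apply/eqP; exact: pp.1.
Qed.

HB.instance Definition _ :=
  Order.hasBottom.Build (Order.Disp tt tt) L ret_le0x.
HB.instance Definition _ :=
  Order.hasTop.Build (Order.Disp tt tt) L ret_lex1.

Lemma lambdaI (a b : K A) :
  lambda a `&` lambda b = lambda (inK (KA (K_compact a) (K_compact b))).
Proof.
by apply: ret_eqP => p pp; rewrite belowI // !below_lambda // commutator_prime.
Qed.

Lemma lambdaU (a b : K A) :
  lambda a `|` lambda b = lambda (inK (compactU (K_compact a) (K_compact b))).
Proof. by apply: ret_eqP => p pp; rewrite belowU // !below_lambda // leUx. Qed.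

Lemma lambda0 : lambda (inK compact0) = \bot.
Proof. by []. Qed.

Lemma lambda1 : lambda (inK (semidegenerate_compact1 V_sd AV)) = \top.
Proof. by []. Qed.

Definition star (t : con A) : set L :=
  fun x => exists2 a : K A, sval a <= t & x = lambda a.

End Reticulation.

Arguments lambda {S V} V_sd {A} AV KA a.
Arguments star {S V} V_sd {A} AV KA t.

Definition Ann d (L : tbDistrLatticeType d) (I : set L) : set L :=
  fun x => forall y, I y -> x `&` y = \bot.

(* Main.v *)
Require Import Defs.
From mathcomp Require Import all_boot all_order.
From mathcomp Require Import boolp classical_sets.

Set Implicit Arguments.
Unset Strict Implicit.
Unset Printing Implicit Defensive.

Import Order.TTheory.
Local Open Scope order_scope.

(** Both sides are determined by the primes above a congruence. Let
    [a] be compact. A prime contains the commutator of two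
    congruences exactly when it contains one of them, and [rho \bot] is the
    meet of all primes. Hence the two conditions
      - [lambda a] annihilates [lambda b] for every compact [b <= theta],
      - [a] is below the residuum of [theta] and [rho \bot]
    both turn out to say that every prime contains [a] or [theta]: this is
    [Ann_star_lambda] for the first and [le_residuum_rho] for the second.

    What remains is to pass to a join at a fixed prime. In the annihilator, a
    prime missing [a] contains every compact [b <= theta], hence their join
    [theta]. In the residuum, a prime missing [theta] contains every [c] whose
    commutator with [theta] is below [rho \bot], hence the join of these.

    The common condition depends on [a] only through [lambda a], so it does
    not matter which compact congruence represents an element of [star].
    The semiprime case is the substitution of [\bot] for [rho \bot]. *)

Section PrimesAbove.
Context {S : signature} {V : variety S} {A : algebra S}.
Implicit Types a b t p : con A.

Lemma le_rhoP a b :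
  a <= rho V b <-> forall p, prime_con V p -> b <= p -> a <= p.
Proof.
split=> [/con_infP h p pp bp|h]; first by apply: h; split.
by apply/con_infP => p [pp bp]; exact: h.
Qed.

Lemma principal_compact (x y : A) :
  compact (con_gen (fun z t : A => z = x /\ t = y)).
Proof.
apply/compactP; exists 1%N, (fun=> x), (fun=> y); congr con_gen.
by do 2!apply: funext => ?; apply: propext; split=> [|[]//]; exists ord0.
Qed.

(** A congruence is the join of the principal congruences below it, so it is
    determined by its compact lower bounds. *)
Lemma le_compactP a b :
  a <= b <-> forall c, compact c -> c <= a -> c <= b.
Proof.
split=> [ab c _ ca|h]; first exact: le_trans ca ab.
apply/con_leP => x y axy.
have /con_genP : con_gen (fun z t : A => z = x /\ t = y) <= b.
  apply: h; first exact: principal_compact.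
  by apply/con_genP => _ _ [-> ->].
exact.
Qed.

(** The residuum is the join of the congruences [c] whose commutator with [t]
    is below [rho b]. A prime above [b] but not above [t] contains each such
    [c], hence also their join. *)
Lemma le_residuum_rho t a b : V A ->
  a <= residuum V t (rho V b) <->
  forall p, prime_con V p -> b <= p -> a <= p \/ t <= p.
Proof.
move=> AV; split=> [a_le p pp bp|h].
  have [tp|ntp] := boolP (t <= p); [by right|left].
  apply: (le_trans a_le); apply/con_supP => c /le_rhoP/(_ p pp bp).
  by rewrite (commutator_prime AV) // (negbTE ntp).
have /con_supP := lexx (residuum V t (rho V b)); apply.
apply/le_rhoP => p pp bp; rewrite (commutator_prime AV) // orbC.
exact/orP/h.
Qed.

End PrimesAbove.

Section Annihilator.
Context {S : signature} {V : variety S} (V_sd : semidegenerate V).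
Context {A : algebra S} (AV : V A) (KA : K_commutator_closed V A).
Local Notation lambda := (lambda V_sd AV KA).
Local Notation star := (star V_sd AV KA).

Lemma lambda_below (a b : K A) p : lambda a = lambda b -> prime_con V p ->
  (sval a <= p) = (sval b <= p).
Proof. by move/lambda_eq/rho_prime; exact. Qed.

Lemma lambdaI_eq0 (a b : K A) :
  lambda a `&` lambda b = \bot <->
  forall p, prime_con V p -> sval a <= p \/ sval b <= p.
Proof.
rewrite lambdaI -lambda0; split=> [e p pp|h].
  by apply/orP; rewrite -(commutator_prime AV) // (lambda_below e) //= le0x.
apply/lambda_eq/rho_prime => p pp /=.
by rewrite (commutator_prime AV) // le0x; exact/orP/h.
Qed.

(** The exchange of quantifiers is the point: if a prime does not contain [a],
    it contains all compact [b <= t], and so [t] itself. *)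
Lemma Ann_star_lambda (t : con A) (a : K A) :
  Ann (star t) (lambda a) <->
  forall p, prime_con V p -> sval a <= p \/ t <= p.
Proof.
split=> [h p pp|h _ [b bt ->]].
  have [ap|nap] := boolP (sval a <= p); [by left|right].
  apply/le_compactP => b cb bt.
  have /lambdaI_eq0/(_ p pp) : lambda a `&` lambda (inK cb) = \bot.
    by apply: h; exists (inK cb).
  by rewrite (negbTE nap) => -[].
apply/lambdaI_eq0 => p pp.
by case: (h p pp) => [|tp]; [left|right; exact: le_trans bt tp].
Qed.

Lemma Ann_star (t : con A) :
  Ann (star t) = star (residuum V t (rho V \bot)).
Proof.
apply: funext => x; apply: propext; split=> [|[a + ->]].
  rewrite -[x](ret_reprK (V_sd := V_sd) (AV := AV) (KA := KA)).
  move=> /Ann_star_lambda h; exists (ret_repr x) => //.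
  by apply/le_residuum_rho => // p pp _; exact: h.
move/(le_residuum_rho _ _ _ AV) => h; apply/Ann_star_lambda => p pp.
by apply: h => //; exact: le0x.
Qed.

End Annihilator.

Theorem proposition3p9 (S : signature) (V : variety S)
    (V_cm : congruence_modular V) (V_sd : semidegenerate V)
    (A : algebra S) (AV : V A) (KA : K_commutator_closed V A)
    (theta : con A) :
  Ann (star V_sd AV KA theta)
    = star V_sd AV KA (residuum V theta (rho V (\bot : con A)%O)) /\
  (semiprime V A ->
   Ann (star V_sd AV KA theta) = star V_sd AV KA (perp V theta)).
Proof.
split=> [|sp]; first exact: Ann_star.
by rewrite Ann_star sp.
Qed.
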